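(* Let $d\ge2$ and let $\mathbf{X}=(X_1,\dots,X_d)$ be a random vector whose marginals are all unit Fréchet, i.e. $\mathbb{P}(X_i\le x)=\exp(-x^{-1})$ for $x>0$. Suppose there are $\eta\in(0,1]$ and a slowly varying function $L$ such that $$\max_{i<j}\mathbb{P}(X_i>\gamma,X_j>\gamma)\sim L(\gamma)\,\gamma^{-1/\eta}\qquad\text{as }\gamma\to\infty.$$ Let $E(\gamma)=\sum_{i=1}^d\mathbf{1}\{X_i>\gamma\}$ and consider the estimator of $\alpha(\gamma)=\mathbb{P}(\max_i X_i>\gamma)$ $$\hat\alpha_1(\gamma)=\sum_{i=1}^d\mathbb{P}(X_i>\gamma)+(1-E(\gamma))\,\mathbf{1}\{E(\gamma)\ge2\}.$$ Then: (i) $\hat\alpha_1$ has bounded relative error if $\eta<1/2$, or if $\eta=1/2$ and $L(\gamma)\not\to\infty$ as $\gamma\to\infty$; (ii) $\hat\alpha_1$ has logarithmic efficiency if $\eta=1/2$.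
   Context: Here $\mathbf{1}\{\cdot\}$ denotes the indicator function, and $f(x)\sim g(x)$ means $\lim_{x\to\infty}f(x)/g(x)=1$. A function $L$ is slowly varying (at $\infty$) if $L(cx)/L(x)\to1$ as $x\to\infty$ for every $c>0$. The number $\eta$ is the largest of the residual tail indices $\eta_{ij}$ of the pairs $(X_i,X_j)$, where $\eta_{ij}\in(0,1]$ is defined by $\mathbb{P}(X_i>\gamma,X_j>\gamma)\sim L_{ij}(\gamma)\gamma^{-1/\eta_{ij}}$ with $L_{ij}$ slowly varying, and $L$ is the slowly varying function associated with the maximal pair. An estimator $\hat p_\gamma$ of a rare probability $p_\gamma$ (with $p_\gamma\to0$ as $\gamma\to\infty$) has logarithmic efficiency if for all $\epsilon>0$, $\limsup_{\gamma\to\infty}\operatorname{Var}(\hat p_\gamma)/p_\gamma^{2-\epsilon}=0$; it has bounded relative error if $\limsup_{\gamma\to\infty}\operatorname{Var}(\hat p_\gamma)/p_\gamma^{2}<\infty$.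
   Formalization: In (i) with η=1/2, the condition ''L(γ) does not tend to ∞'' is replaced by limsup L(γ) < ∞, since the claim fails for slowly varying L that oscillate with finite liminf and infinite limsup. *)

(* Defs.v *)
From HB Require Import structures.
From mathcomp Require Import all_boot all_order all_algebra.
From mathcomp Require Import all_classical all_reals all_analysis.

Set Implicit Arguments.
Unset Strict Implicit.
Unset Printing Implicit Defensive.

Import Order.TTheory GRing.Theory Num.Theory.
Import numFieldTopology.Exports numFieldNormedType.Exports.

Local Open Scope classical_set_scope.
Local Open Scope ring_scope.

(* As y / 0 = 0 in R, this forces g to be nonzero near +oo; the same remark
   applies to L in slowly_varying. *)
Definition asymp_equiv (R : realType) (f g : R -> R) : Prop :=
  f x / g x @[x --> +oo] --> (1 : R).

Definition slowly_varying (R : realType) (L : R -> R) : Prop :=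
  forall c : R, 0 < c -> L (c * x) / L x @[x --> +oo] --> (1 : R).

Definition limsup_pinfty (R : realType) (f : R -> \bar R) : \bar R :=
  limf_esup f (pinfty_nbhs R).

Section Probability.
Context (disp : measure_display) (T : measurableType disp) (R : realType).
Variable P : probability T R.

Definition unit_Frechet (X : T -> R) : Prop :=
  forall x : R, 0 < x -> P [set w | X w <= x] = (expR (- x^-1))%:E.

(* A family of estimators Z gamma of p gamma, indexed by gamma.  Variances and
   ratios are taken in \bar R, where y / 0 = y * +oo, so that an infinite
   variance or a vanishing p gamma is not hidden by a default value. *)
Definition bounded_relative_error (Z : R -> T -> R) (p : R -> R) : Prop :=
  (limsup_pinfty (fun gamma => variance P (Z gamma) / (p gamma ^+ 2)%:E)
     < +oo)%E.

Definition logarithmic_efficiency (Z : R -> T -> R) (p : R -> R) : Prop :=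
  forall eps : R, 0 < eps ->
    (limsup_pinfty
       (fun gamma => variance P (Z gamma) / (p gamma `^ (2 - eps))%:E)
     = 0)%E.

Variables (d : nat) (X : 'I_d -> T -> R).

(* The default value 0 is harmless: probabilities are nonnegative and, for
   d >= 2, there is at least one pair i < j. *)
Definition max_pair_tail (gamma : R) : R :=
  \big[Num.max/0]_(ij : 'I_d * 'I_d | (ij.1 < ij.2)%N)
     fine (P [set w | X ij.1 w > gamma /\ X ij.2 w > gamma]).

(* The maximum is taken in \bar R with the neutral default value -oo. *)
Definition max_tail (gamma : R) : R :=
  fine (P [set w | (\big[maxe/-oo]_(i < d) (X i w)%:E > gamma%:E)%E]).

Definition exceedances (gamma : R) (w : T) : nat :=
  (\sum_(i < d) (X i w > gamma)%R)%N.

Definition alpha_hat1 (gamma : R) (w : T) : R :=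
  \sum_(i < d) fine (P [set v | X i v > gamma])
  + (1 - (exceedances gamma w)%:R) * (2 <= exceedances gamma w)%N%:R.

End Probability.

(* Main.v *)
Require Import Defs.
From HB Require Import structures.
From mathcomp Require Import all_boot all_order all_algebra.
From mathcomp Require Import all_classical all_reals all_analysis.
From mathcomp Require Import measurable_realfun ring lra.
Import Order.TTheory GRing.Theory Num.Theory.
Import numFieldTopology.Exports numFieldNormedType.Exports.
Local Open Scope classical_set_scope.
Local Open Scope ring_scope.

(* Since (1 - E) 1{E >= 2} is bounded by d and vanishes unless two coordinates
   exceed gamma, the variance of the estimator is at most d^4 M(gamma), where
   M is the maximal pair tail, while alpha(gamma) >= P(X_1 > gamma)
   = 1 - exp(- 1 / gamma) >= 1 / (1 + gamma).  It remains to bound M.  The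
   function L need not be measurable, so Karamata's representation of slowly
   varying functions is not available; but M is nonincreasing and
   M(2x) / M(x) --> 2^(- 1/eta), which by dyadic iteration gives
   M(x) = O(x^(-s)) for every s < 1/eta.  When eta = 1/2 this is too weak for
   bounded relative error, and L = O(1) is used directly. *)

(** * Limits superior at infinity *)

Lemma limsup_pinfty_le (R : realType) (f : R -> \bar R) (c : \bar R) :
  (\forall x \near +oo, (f x <= c)%E) -> (limsup_pinfty f <= c)%E.
Proof.
move=> fc; apply: ge_ereal_inf.
exists (ereal_sup (f @` [set x | (f x <= c)%E])).
  by exists [set x | (f x <= c)%E].
by apply: ge_ereal_sup => _ [x ? <-].
Qed.

Lemma limsup_pinfty_lty (R : realType) (f : R -> R) :
  (limsup_pinfty (fun x => (f x)%:E) < +oo)%E ->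
  exists C : R, \forall x \near +oo, f x <= C.
Proof.
move=> /ereal_inf_lt[_ [V FV <-]] supV.
have fV x : V x -> ((f x)%:E <= ereal_sup ((fun x => (f x)%:E) @` V))%E.
  by move=> Vx; apply: ereal_sup_ubound; exists x.
case: (ereal_sup _) supV fV => [C| |] // _ fV.
  by exists C; apply: filterS FV => x /fV; rewrite lee_fin.
(* The supremum is -oo here, so each x in V would give [f x <= -oo], which is absurd. *)
by exists 0; apply: filterS FV => x /fV.
Qed.

(** * Power decay from doubling *)

(** Doubling x does not increase x^s M(x). Halving x until it lies in [b, 2b] thus reduces to that
    interval, where monotonicity gives the bound (2b)^s M(b). *)
Lemma doubling_near_le_powR (R : realType) (M : R -> R) (s : R) :
  0 <= s -> {homo M : x y /~ x <= y} -> (forall x, 0 <= M x) ->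
  (\forall x \near +oo, M (2 * x) <= 2 `^ (- s) * M x) ->
  exists C : R, \forall x \near +oo, M x <= C * x `^ (- s).
Proof.
move=> s0 Mni M0 [a [_ Ma]].
(* The hypothesis holds strictly beyond a; b is also positive, so powers of x >= b are
   invertible. *)
pose b := Num.max a 0 + 1.
have b0 : 0 < b by rewrite ltr_pwDr// le_max lexx orbT.
have Mb x : b <= x -> M (2 * x) <= 2 `^ (- s) * M x.
  by move=> bx; apply: Ma; rewrite (lt_le_trans _ bx)// ltr_pwDr// le_max lexx.
pose C := (2 * b) `^ s * M b.
have dyadic n x : b <= x -> x < 2 ^+ n * b -> x `^ s * M x <= C.
  elim: n x => [|n IHn] x bx; first by rewrite expr0 mul1r ltNge bx.
  rewrite exprS => xn; have [x2b|x2b] := leP x (2 * b).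
    rewrite ler_pM ?powR_ge0//; last exact: Mni.
    by rewrite ge0_ler_powR ?nnegrE//; lra.
  have x2E : x = 2 * (x / 2) by field.
  have bx2 : b <= x / 2 by lra.
  rewrite {1 2}x2E powRM//; last by lra.
  apply: (le_trans _ (IHn (x / 2) bx2 _)); last by rewrite ltr_pdivrMr//; lra.
  rewrite mulrAC mulrC ler_wpM2l ?powR_ge0//.
  have := Mb _ bx2; rewrite powRN [leRHS]mulrC ler_pdivlMr ?powR_gt0//.
  by rewrite mulrC.
exists C; exists b; split; first exact: num_real.
move=> x /ltW bx; rewrite powRN ler_pdivlMr ?powR_gt0 ?(lt_le_trans b0)//.
rewrite mulrC; apply: (dyadic (Num.bound (x / b))) => //.
by rewrite -ltr_pdivrMr// upper_nthrootP.
Qed.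

(** The ratio M(2x)/M(x) tends to 2^(-t), and 2^(-t) < 2^(-s) leaves room for the doubling
    inequality to hold eventually. *)
Lemma tail_le_powR (R : realType) (M L : R -> R) (t s : R) :
  0 <= s -> s < t -> {homo M : x y /~ x <= y} -> (forall x, 0 <= M x) ->
  slowly_varying L -> asymp_equiv M (fun x => L x * x `^ (- t)) ->
  exists C : R, \forall x \near +oo, M x <= C * x `^ (- s).
Proof.
move=> s0 st Mni M0 sL ML; apply: doubling_near_le_powR => //.
pose g x := L x * x `^ (- t).
have ML2 : M (2 * x) / g (2 * x) @[x --> +oo] --> (1 : R).
  apply: cvg_comp ML => A [a [ar aA]]; exists (a / 2); split.
    exact: num_real.
  by move=> x ax; apply: aA; rewrite mulrC -ltr_pdivrMr.
have Mg0 : \forall x \near +oo, 0 < M x / g x.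
  exact: (cvgr_gt _ ML).
have Mratio : M (2 * x) / M x @[x --> +oo] --> (2 `^ (- t) : R).
  have : (M (2 * x) / g (2 * x)) * (L (2 * x) / L x) * 2 `^ (- t)
           * (M x / g x)^-1 @[x --> +oo] --> (1 * 1 * 2 `^ (- t) * 1^-1 : R).
    apply: cvgM; last by apply: cvgV => //; exact: oner_neq0.
    by apply: cvgMr_tmp; apply: cvgM => //; exact: sL.
  rewrite !mul1r invr1 mulr1; apply: cvg_trans.
  apply: near_eq_cvg; near=> x.
  have x0 : 0 < x by near: x; exact: nbhs_pinfty_gt.
  have Mgx : 0 < M x / g x by near: x.
  have Mgx2 : 0 < M (2 * x) / g (2 * x) by near: x; exact: (cvgr_gt _ ML2).
  (* A positive quotient rules out the default value of division by 0, which makes the cancellations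
     below legitimate. *)
  have nz y : 0 < M y / g y -> [/\ M y != 0, L y != 0 & y `^ (- t) != 0].
    move=> h; split; apply: contraTneq h; rewrite /g => ->;
      by rewrite ?(mul0r, mulr0, invr0, ltxx).
  have [? ? ?] := nz _ Mgx; have [? ? ?] := nz _ Mgx2.
  have ? : 2 `^ (- t) != 0 :> R by rewrite gt_eqF ?powR_gt0.
  rewrite /g powRM ?(ltW x0)//; field; exact/and5P.
have : \forall x \near +oo, M (2 * x) / M x <= 2 `^ (- s).
  apply: (cvgr_le _ Mratio); rewrite /powR gt_eqF// ltr_expR.
  by rewrite ltr_pM2r ?ltrN2// ln_gt0// ltr1n.
move=> Mle; near=> x.
have Mx0 : 0 < M x.
  rewrite lt_neqAle M0 andbT eq_sym.
  have : 0 < M x / g x by near: x.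
  by apply: contraTneq => ->; rewrite mul0r ltxx.
by rewrite -ler_pdivrMr//; near: x.
Unshelve. all: by end_near. Qed.

(** * Variance of the estimator *)

Lemma Lfun_bounded (disp : measure_display) (T : measurableType disp)
    (R : realType) (P : probability T R) (p C : R) (f : T -> R) :
  0 <= p -> measurable_fun setT f -> (forall w, `|f w| <= C) ->
  f \in Lfun P p%:E.
Proof.
move=> p0 mf fC; rewrite inE/=; apply/andP; split; rewrite inE//=.
rewrite /finite_norm unlock poweR_lty//; apply: integrable_lty => //.
have mfp : measurable_fun setT (fun x => `|f x| `^ p).
  by apply: (measurableT_comp (measurable_powR p)); exact: measurableT_comp.
apply: (@measurable_bounded_integrable _ _ _ P (fun x => `|f x| `^ p)) => //.
  by rewrite ltey_eq fin_num_measure.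
exists (C `^ p); split; first exact: num_real.
move=> x Cx w _ /=; rewrite ger0_norm ?powR_ge0// (le_trans _ (ltW Cx))//.
by rewrite ge0_ler_powR// nnegrE (le_trans _ (fC w)).
Qed.

Section Estimator.
Context (disp : measure_display) (T : measurableType disp) (R : realType).
Variables (P : probability T R) (d : nat) (X : 'I_d -> {RV P >-> R}).

Let M := max_pair_tail P (fun i => X i).
Let tail i g := [set w | X i w > g].
Let pair_tail (ij : 'I_d * 'I_d) g := [set w | X ij.1 w > g /\ X ij.2 w > g].

Lemma measurable_tail i g : measurable (tail i g).
Proof.
have -> : tail i g = X i @^-1` `]g, +oo[.
  by apply/seteqP; split => w; rewrite /tail /= in_itv/= andbT.
by rewrite -[X in measurable X]setTI; exact: measurable_funP.
Qed.

Lemma measurable_pair_tail ij g : measurable (pair_tail ij g).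
Proof. exact: measurableI (measurable_tail _ _) (measurable_tail _ _). Qed.

Lemma fine_probability_le (A B : set T) : measurable A -> measurable B ->
  A `<=` B -> fine (P A) <= fine (P B).
Proof.
move=> mA mB AB; rewrite fine_le ?fin_num_measure//.
by rewrite le_measure ?inE.
Qed.

Lemma max_pair_tail_ge0 g : 0 <= M g.
Proof. exact: bigmax_ge_id. Qed.

Lemma max_pair_tail_ni : {homo M : x y /~ x <= y}.
Proof.
move=> x y xy; apply: le_bigmax2 => ij _.
apply: fine_probability_le; [exact: measurable_pair_tail..|].
by move=> w /= [? ?]; split; apply: le_lt_trans xy _.
Qed.

Lemma exceedances_indic g w :
  (exceedances (fun i => X i) g w)%:R = \sum_(i < d) \1_(tail i g) w :> R.
Proof.
rewrite natr_sum; apply: eq_bigr => i _; rewrite indicE; congr (_%:R).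
by congr nat_of_bool; apply/idP/idP => [h|/set_mem//]; apply/mem_set.
Qed.

(* As E is a natural number, (1 - E) 1{E >= 2} = min(0, 1 - E). *)
Let correction g w : R := Num.min 0 (1 - \sum_(i < d) \1_(tail i g) w).

(** The sum of marginal tails is deterministic, so only the correction contributes to the
    variance. *)
Lemma alpha_hat1E g :
  alpha_hat1 P (fun i => X i) g =
  cst (\sum_(i < d) fine (P (tail i g))) \+ correction g.
Proof.
apply/funext => w; rewrite /alpha_hat1 /correction /= -exceedances_indic.
congr (_ + _).
case: exceedances => [|[|n]]; rewrite ?mulr0 ?mulr1.
- by rewrite subr0 min_l.
- by rewrite subrr min_l.
- by rewrite min_r// subr_le0 ler1n.
Qed.

Lemma measurable_correction g : measurable_fun setT (correction g).
Proof.
apply: measurable_minr => //; apply: measurable_funB => //.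
by apply: measurable_sum => i; exact/measurable_indic/measurable_tail.
Qed.

(** The value 0 encodes the condition i < j, so that sums run over all pairs; d^2 is a bound for (E
    - 1)^2. *)
Let pair_weight (ij : 'I_d * 'I_d) : R :=
  if (ij.1 < ij.2)%N then d%:R ^+ 2 else 0.

Lemma pair_weight_ge0 ij : 0 <= pair_weight ij.
Proof. by rewrite /pair_weight; case: ifP => // _; exact: exprn_ge0. Qed.

(** The correction vanishes for E <= 1. For E >= 2 some pair i < j exceeds g, and its term alone is
    d^2 >= (E - 1)^2. *)
Lemma correction_sqr_le g w : correction g w ^+ 2 <=
  \sum_(ij : 'I_d * 'I_d) pair_weight ij * \1_(pair_tail ij g) w.
Proof.
have term_ge0 ij : 0 <= pair_weight ij * \1_(pair_tail ij g) w.
  by rewrite mulr_ge0 ?pair_weight_ge0.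
have sum_ge0 :
    0 <= \sum_(ij : 'I_d * 'I_d) pair_weight ij * \1_(pair_tail ij g) w.
  exact: sumr_ge0.
rewrite /correction -exceedances_indic.
have [E2|] := leqP 2 (exceedances (fun i => X i) g w); last first.
  by rewrite ltnS => E1; rewrite min_l ?expr0n//= subr_ge0 lern1.
have Ed : (exceedances (fun i => X i) g w <= d)%N.
  by rewrite -[leqRHS]card_ord -sum1_card leq_sum// => i _; case: (_ < _).
have WE : Num.min 0 (1 - (exceedances (fun i => X i) g w)%:R) ^+ 2
    <= d%:R ^+ 2 :> R.
  rewrite min_r ?subr_le0 ?ler1n ?(ltnW E2)// -sqrrN opprB ler_sqr ?nnegrE//.
    by rewrite lerBlDr (le_trans (_ : _ <= d%:R)) ?ler_nat ?lerDl.
  by rewrite subr_ge0 ler1n ltnW.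
apply: (le_trans WE).
have [i iX [j jX ij]] : exists2 i, X i w > g & exists2 j, X j w > g & (i < j)%N.
  have : (1 < #|[pred i | (X i w > g)%R]|)%N.
    by rewrite -sum1_card big_mkcond.
  case/card_gt1P => i [j [iX jX ij]].
  have := ij; rewrite neq_ltn => /orP[?|?]; first by exists i => //; exists j.
  by exists j => //; exists i.
rewrite (bigD1 (i, j))//= indicE mem_set//= mulr1 /pair_weight ij lerDl.
by apply: sumr_ge0 => kl _; exact: term_ge0.
Qed.

(** The variance is at most the second moment of the correction, hence at most a sum of d^2 terms,
    each bounded by d^2 M(g). *)
Lemma variance_alpha_hat1_le g :
  (variance P (alpha_hat1 P (fun i => X i) g) <= (d%:R ^+ 4 * M g)%:E)%E.
Proof.
have WL p : 0 <= p -> correction g \in Lfun P p%:E.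
  move=> p0; apply: (@Lfun_bounded _ _ _ _ _ (1 + \sum_(i < d) 1)) => //.
    exact: measurable_correction.
  move=> w; rewrite /correction.
  have S0 : 0 <= \sum_(i < d) \1_(tail i g) w :> R.
    by apply: sumr_ge0 => i _.
  have S1 : \sum_(i < d) \1_(tail i g) w <= \sum_(i < d) 1 :> R.
    by apply: ler_sum => i _; rewrite indicE lern1 leq_b1.
  rewrite minEle; case: ifPn => [_|]; first by rewrite normr0; lra.
  by rewrite -ltNge => ?; rewrite ltr0_norm//; lra.
rewrite alpha_hat1E varianceD_cst_l ?WL// varianceE ?WL//.
have W1 : expectation P (correction g) \is a fin_num.
  by rewrite expectation_fin_num// WL.
apply: (@le_trans _ _ (expectation P (fun w => correction g w ^+ 2))).
  rewrite leeBlDr ?fin_numX//.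
  rewrite (_ : correction g ^+ 2 = (fun w => correction g w ^+ 2)).
    by rewrite leeDl// -(fineK W1) -EFin_expe lee_fin sqr_ge0.
  by apply/funext => w; rewrite expr2.
have mind ij : measurable_fun setT (\1_(pair_tail ij g) : T -> R).
  exact/measurable_indic/measurable_pair_tail.
have mterm ij :
    measurable_fun setT (fun w => pair_weight ij * \1_(pair_tail ij g) w).
  exact: measurable_funM.
apply: (@le_trans _ _ (expectation P
    (fun w => \sum_(ij : 'I_d * 'I_d) pair_weight ij * \1_(pair_tail ij g) w))).
  apply: expectation_le.
  - apply: measurable_funX; exact: measurable_correction.
  - exact: measurable_sum.
  - by move=> w; rewrite sqr_ge0.
  - by move=> w; rewrite sumr_ge0// => ij _; rewrite mulr_ge0 ?pair_weight_ge0.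
  - by apply: aeW => w; exact: correction_sqr_le.
rewrite unlock; under eq_integral do rewrite -sumEFin.
rewrite ge0_integral_sum//; last 2 first.
- by move=> ij; apply/measurable_EFinP.
- by move=> ij w _; rewrite lee_fin mulr_ge0 ?pair_weight_ge0.
apply: (@le_trans _ _ (\sum_(ij : 'I_d * 'I_d) (d%:R ^+ 2 * M g)%:E)%E).
  apply: lee_sum => ij _; under eq_integral do rewrite EFinM.
  rewrite ge0_integralZl//; last 2 first.
  - exact/measurable_EFinP.
  - by rewrite lee_fin pair_weight_ge0.
  rewrite integral_indic//; last exact: measurable_pair_tail.
  rewrite setIT /pair_weight; case: ifPn => [ij_lt|_]; last first.
    by rewrite mul0e lee_fin mulr_ge0 ?exprn_ge0 ?max_pair_tail_ge0.
  rewrite [leRHS]EFinM lee_wpmul2l ?lee_fin ?exprn_ge0//.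
  rewrite -[leLHS]fineK; last exact/fin_num_measure/measurable_pair_tail.
  by rewrite lee_fin (le_bigmax_cond 0 (fun kl => fine (P (pair_tail kl g)))).
rewrite sumEFin sumr_const card_prod card_ord lee_fin -[leLHS]mulr_natr natrM.
by rewrite le_eqVlt; apply/orP; left; apply/eqP; ring.
Qed.

(** * Bounds on the rare probability and the relative variance *)

Lemma max_tail_bounds (hX : forall i : 'I_d, unit_Frechet P (X i))
    (hd : (2 <= d)%N) g : 0 < g ->
  (1 + g)^-1 <= max_tail P (fun i => X i) g <= 1.
Proof.
move=> g0; rewrite /max_tail; set A := [set w | _].
have AE : A = \bigcup_(i in [set: 'I_d]) tail i g.
  apply/seteqP; split => w; rewrite /A /=.
    by move=> /bigmax_gtP[//|[i _]]; rewrite lte_fin => ?; exists i.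
  move=> [i _ /= gX]; apply: lt_le_trans (le_bigmax _ _ i).
  by rewrite lte_fin.
have mA : measurable A.
  rewrite AE; apply: fin_bigcup_measurable => // i _; exact: measurable_tail.
apply/andP; split; last first.
  by rewrite -lee_fin fineK ?fin_num_measure// probability_le1.
(* This is index 0: [ltnW hd] reads as [0 < d]. *)
pose i : 'I_d := Ordinal (ltnW hd).
have PtailE : fine (P (tail i g)) = 1 - expR (- g^-1).
  have -> : tail i g = ~` [set w | X i w <= g].
    apply/seteqP; split => w; rewrite /tail /=; first by rewrite ltNge => /negP.
    by move/negP; rewrite -ltNge.
  rewrite probability_setC ?hX// -[X in measurable X]setCK.
  apply: measurableC; have := measurable_tail i g; congr measurable.
  apply/seteqP; split => w; rewrite /tail /=; first by rewrite ltNge => /negP.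
  by move/negP; rewrite -ltNge.
apply: (@le_trans _ _ (fine (P (tail i g)))); last first.
  apply: fine_probability_le => //; first exact: measurable_tail.
  by rewrite AE => w ?; exists i.
rewrite PtailE expRN.
(* With u = 1/g, 1 - exp(-u) >= 1 - 1/(1 + u) = 1/(1 + g). *)
have e1 : 1 + g^-1 <= expR g^-1 := expR_ge1Dx _.
have gV : 0 < g^-1 by rewrite invr_gt0.
have : (expR g^-1)^-1 <= (1 + g^-1)^-1.
  by rewrite lef_pV2 ?posrE ?expR_gt0//; lra.
have -> : (1 + g^-1)^-1 = 1 - (1 + g)^-1.
  by field; rewrite !gt_eqF//=; lra.
lra.
Qed.

(** Since p <= 1, p^(-r) <= p^(-s), and 1/p <= 1 + g <= 2g. The second exponent s allows r = 2 - eps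
    to be negative, while y^s stays monotone. *)
Lemma relative_variance_le (hX : forall i : 'I_d, unit_Frechet P (X i))
    (hd : (2 <= d)%N) g r s : 1 <= g -> r <= s -> 0 <= s ->
  (variance P (alpha_hat1 P (fun i => X i) g)
     / (max_tail P (fun i => X i) g `^ r)%:E
   <= (d%:R ^+ 4 * M g * (2 * g) `^ s)%:E)%E.
Proof.
move=> g1 rs s0; set p := max_tail _ _ _.
have g0 : 0 < g by lra.
have /andP[pl p1] : (1 + g)^-1 <= p <= 1 by exact: max_tail_bounds.
have gp0 : 0 < (1 + g)^-1 by rewrite invr_gt0; lra.
have p0 : 0 < p by apply: lt_le_trans pl.
rewrite inver gt_eqF ?powR_gt0// EFinM.
apply: lee_pmul; first exact: variance_ge0.
- by rewrite lee_fin invr_ge0 powR_ge0.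
- exact: variance_alpha_hat1_le.
rewrite lee_fin; apply: (@le_trans _ _ (p `^ s)^-1).
  by rewrite lef_pV2 ?posrE ?powR_gt0// ger_powR// p0 p1.
rewrite -powR_inv1 ?powR_ge0// powRAC powR_inv1 ?(ltW p0)//.
rewrite ge0_ler_powR ?nnegrE ?invr_ge0 ?(ltW p0)//; first lra.
apply: (@le_trans _ _ (1 + g)); last lra.
by rewrite -[leRHS]invrK lef_pV2 ?posrE.
Qed.

End Estimator.

(** * The two efficiency statements *)

Lemma powR_near_ge (R : realType) (a B : R) : 0 < a ->
  \forall x \near +oo, B <= x `^ a.
Proof.
move=> a0; have B0 : 0 <= Num.max B 0 by rewrite le_max lexx orbT.
exists (Num.max B 0 `^ a^-1); split; first exact: num_real.
move=> x Bx; apply: (@le_trans _ _ (Num.max B 0)); first by rewrite le_max lexx.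
rewrite -[leLHS]powRr1// -(mulVf (lt0r_neq0 a0)) powRrM.
rewrite ge0_ler_powR ?nnegrE ?powR_ge0 ?(ltW a0)// ltW//.
by rewrite (le_lt_trans _ Bx) ?powR_ge0.
Qed.

(* The condition "L does not tend to infinity" is limsup L < +oo: L tends to
   infinity along no sequence.  The bare negation of "L x --> +oo" would not
   suffice: a slowly varying L may oscillate with liminf L < limsup L = +oo, and
   then for d = 2 and eta = 1/2 the relative error is unbounded. *)
Theorem proposition6 (disp : measure_display) (T : measurableType disp)
    (R : realType) (P : probability T R) (d : nat) (hd : (2 <= d)%N)
    (X : 'I_d -> {RV P >-> R})
    (hX : forall i : 'I_d, unit_Frechet P (X i))
    (eta : R) (heta0 : 0 < eta) (heta1 : eta <= 1)
    (L : R -> R) (hL : slowly_varying L)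
    (hpair : asymp_equiv (max_pair_tail P (fun i => X i))
               (fun gamma => L gamma * gamma `^ (- eta^-1))) :
  ((eta < 1 / 2
    \/ (eta = 1 / 2 /\ (limsup_pinfty (fun gamma => (L gamma)%:E) < +oo)%E)) ->
   bounded_relative_error P (alpha_hat1 P (fun i => X i))
     (max_tail P (fun i => X i)))
  /\
  (eta = 1 / 2 ->
   logarithmic_efficiency P (alpha_hat1 P (fun i => X i))
     (max_tail P (fun i => X i))).
Proof.
set M := max_pair_tail P (fun i => X i) in hpair *.
have Mni : {homo M : x y /~ x <= y} := @max_pair_tail_ni _ _ _ P d X.
have M0 : forall x, 0 <= M x := @max_pair_tail_ge0 _ _ _ P d X.
have ratio_le := @relative_variance_le _ _ _ P d X hX hd.
split.
  move=> eta_case.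
  (* Both cases reduce to M(x) = O(x^(-2)). If eta < 1/2, then 1/eta > 2 gives the strict gap needed
     by [tail_le_powR]. *)
  have [C MC] : exists C : R, \forall x \near +oo, M x <= C * x `^ (- 2).
    case: eta_case => [eta2|[eta2 /limsup_pinfty_lty[C LC]]].
      apply: (@tail_le_powR _ M L eta^-1) => //.
      by rewrite -[ltLHS]invrK ltf_pV2 ?posrE//; lra.
    (* Eventually M is at most twice its equivalent, and L <= C. *)
    exists (2 * C); near=> x.
    have etaV : eta^-1 = 2 by rewrite eta2 div1r invrK.
    have x0 : 0 < x by near: x; exact: nbhs_pinfty_gt.
    have Lx : L x <= C by near: x.
    have Mg0 : 0 < M x / (L x * x `^ (- eta^-1)).
      by near: x; exact: (cvgr_gt _ hpair).
    have Mg2 : M x / (L x * x `^ (- eta^-1)) <= 2.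
      by near: x; apply: (cvgr_le _ hpair); rewrite ltr1n.
    (* L has no assumed sign; its positivity here follows from M >= 0 and the positive quotient. *)
    have g0 : 0 < L x * x `^ (- eta^-1).
      rewrite ltNge; apply: contraTN Mg0 => g0.
      by rewrite -leNgt mulr_ge0_le0// invr_le0.
    move: Mg2; rewrite ler_pdivrMr// etaV mulrA => /le_trans; apply.
    by rewrite ler_wpM2r ?powR_ge0// ler_wpM2l.
  rewrite /bounded_relative_error.
  (* The 4 comes from (2x)^2 x^(-2). *)
  apply: (@le_lt_trans _ _ (d%:R ^+ 4 * C * 4)%:E); last exact: ltry.
  apply: limsup_pinfty_le; near=> x.
  have x1 : 1 <= x by near: x; exact: nbhs_pinfty_ge.
  have Mx : M x <= C * x `^ (- 2) by near: x.
  rewrite -powR_mulrn; last first.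
    have x0 : 0 < x by lra.
    have /andP[+ _] := @max_tail_bounds _ _ _ P d X hX hd x x0.
    by apply: le_trans; rewrite invr_ge0; lra.
  apply: (le_trans (ratio_le x 2 2 x1 _ _)) => //.
  rewrite lee_fin -/M -mulrA -[leRHS]mulrA ler_wpM2l ?exprn_ge0//.
  rewrite powR_mulrn; last by lra.
  move: Mx; rewrite powRN powR_mulrn; last by lra.
  have x20 : 0 < x ^+ 2 by rewrite exprn_gt0//; lra.
  by rewrite ler_pdivlMr//; lra.
move=> eta2 eps eps0.
have etaV : eta^-1 = 2 by rewrite eta2 div1r invrK.
(* Capping eps at 1 keeps the exponent 2 - e nonnegative, as [relative_variance_le] requires. *)
pose e := Num.min eps 1.
have e0 : 0 < e by rewrite lt_min eps0 ltr01.
have e1 : e <= 1 by rewrite ge_min lexx orbT.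
have ee : e <= eps by rewrite ge_min lexx.
(* Giving up only e/2 in the decay of M leaves x^(2 - e) x^(-(2 - e/2)) = x^(-e/2), which tends to
   0. *)
have [C MC] :
    exists C : R, \forall x \near +oo, M x <= C * x `^ (- (2 - e / 2)).
  by apply: (@tail_le_powR _ M L eta^-1) => //; lra.
apply/eqP; rewrite eq_le; apply/andP; split; last first.
  apply: limf_esup_ge0; first exact: filter_not_empty.
  by move=> x; rewrite mule_ge0 ?variance_ge0// inve_ge0 lee_fin powR_ge0.
apply/lee_addgt0Pr => del del0; rewrite add0e.
(* The ratio is at most D x^(-e/2), which is below [del] once x^(e/2) >= D / [del]. *)
pose D := d%:R ^+ 4 * C * 2 `^ (2 - e).
apply: limsup_pinfty_le; near=> x.
have x1 : 1 <= x by near: x; exact: nbhs_pinfty_ge.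
have x0 : 0 < x by lra.
have Mx : M x <= C * x `^ (- (2 - e / 2)) by near: x.
have xD : D / del <= x `^ (e / 2).
  by near: x; apply: powR_near_ge; lra.
apply: (le_trans (ratio_le x (2 - eps) (2 - e) x1 _ _)); [lra..|].
rewrite lee_fin -/M.
apply: (@le_trans _ _ (D * x `^ (- (e / 2)))).
  have -> : - (e / 2) = - (2 - e / 2) + (2 - e) by field.
  rewrite (@powRD _ x); last first.
    by apply/implyP => _; rewrite gt_eqF.
  rewrite powRM; [|lra..].
  rewrite [leLHS](_ : _ =
    M x * (d%:R ^+ 4 * (2 `^ (2 - e) * x `^ (2 - e)))); last by ring.
  apply: (le_trans (ler_wpM2r _ Mx)).
    by rewrite !mulr_ge0 ?exprn_ge0 ?powR_ge0.
  by rewrite le_eqVlt; apply/orP; left; apply/eqP; rewrite /D; ring.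
rewrite powRN ler_pdivrMr ?powR_gt0//.
by rewrite mulrC -ler_pdivrMr.
Unshelve. all: by end_near. Qed.
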